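(* Let $f: \mathbb{R}^N \to \mathbb{R}$ be convex and $\Lambda$-Lipschitz with respect to the Euclidean norm, where $\Lambda > 0$. Then for any $t \ge 0$, $$\mathbb{P}_\kappa\big( |f - \mathrm{med}(f)| \ge t \big)\le 4 \exp\Big( - \frac{t^2}{144\Lambda^2 |\mathcal{X}|^2} \Big),$$ where $\mathrm{med}(f)$ is a median for $f$ (with respect to $\mathbb{P}_\kappa$).
   Context: Let $L \ge 2$ be an integer, $\kappa = (\kappa_1,\ldots,\kappa_L)$ a vector of positive integers, $N = \kappa_1 + \cdots + \kappa_L$, and $\mathcal{X} = \{x_1,\ldots,x_L\} \subset \mathbb{R}$ a set of $L$ distinct reals with $x_1 < \cdots < x_L$; $|\mathcal{X}| := x_L - x_1$. The multislice is $\Omega_\kappa = \{\omega \in \mathcal{X}^N : \#\{i : \omega_i = x_\ell\} = \kappa_\ell \text{ for } \ell = 1,\ldots,L\}$, with uniform distribution $\mathbb{P}_\kappa$. *)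

(* Defs.v *)
From HB Require Import structures.
From mathcomp Require Import all_boot all_order all_algebra finmap.
From mathcomp Require Import all_classical all_reals all_analysis.
Set Implicit Arguments.
Unset Strict Implicit.
Unset Printing Implicit Defensive.
Import Order.TTheory GRing.Theory Num.Theory.
Local Open Scope classical_set_scope.
Local Open Scope ring_scope.

Definition multislice (R : realType) (L N : nat) (kappa : 'I_L -> nat)
    (x : L.-tuple R) : set 'rV[R]_N :=
  [set w | (forall i : 'I_N, w 0 i \in x) /\
           (forall l : 'I_L, #|[set i : 'I_N | w 0 i == tnth x l]%SET| = kappa l)].

Definition diameter (R : realType) (L : nat) (x : L.-tuple R) : R :=
  x`_L.-1 - x`_0.

(* [fset_set] is junk (empty) on infinite sets, so this is meaningful only when
   [S] is finite and nonempty; see [finite_multislice] and [multislice_neq0]. *)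
Definition uniform_on (R : realType) (T : choiceType) (S A : set T) : R :=
  #|` fset_set (A `&` S)|%:R / #|` fset_set S|%:R.

Definition is_median (R : realType) (T : Type) (P : set T -> R)
    (f : T -> R) (m : R) : Prop :=
  2^-1 <= P [set w | f w <= m] /\ 2^-1 <= P [set w | m <= f w].

(* The library norm on row vectors is the sup norm, hence this definition. *)
Definition enorm (R : realType) (N : nat) (v : 'rV[R]_N) : R :=
  Num.sqrt (\sum_(i < N) v 0 i ^+ 2).

Definition euclidean_lipschitz (R : realType) (N : nat) (Lambda : R)
    (f : 'rV[R]_N -> R) : Prop :=
  forall u v : 'rV[R]_N, `|f u - f v| <= Lambda * enorm (u - v).

Lemma finite_multislice (R : realType) (L N : nat) (kappa : 'I_L -> nat)
    (x : L.-tuple R) : finite_set (multislice (N := N) kappa x).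
Proof.
pose g (h : {ffun 'I_N -> 'I_L}) : 'rV[R]_N := \row_i tnth x (h i).
apply: (@sub_finite_set _ _ (g @` setT)); last first.
  by apply: finite_image; exact: finite_finset.
move=> w [wx _].
have h i : exists l : 'I_L, w 0 i == tnth x l.
  by have /tnthP[l ->] := wx i; exists l.
exists [ffun i => xchoose (h i)] => //.
by apply/rowP => i; rewrite mxE ffunE -(eqP (xchooseP (h i))).
Qed.

Lemma multislice_neq0 (R : realType) (L N : nat) (kappa : 'I_L -> nat)
    (x : L.-tuple R) : sorted <%R x -> N = (\sum_(l < L) kappa l)%N ->
  multislice (N := N) kappa x !=set0.
Proof.
move=> xs NE.
have xu : uniq x by apply: lt_sorted_uniq.
pose s := flatten [seq nseq (kappa l) (tnth x l) | l <- enum 'I_L].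
have sN : size s = N.
  rewrite size_flatten /shape -map_comp sumnE big_map big_enum NE.
  by apply: eq_bigr => l _ /=; rewrite size_nseq.
exists (\row_(i < N) s`_i); split=> [i|l].
  rewrite mxE; have : s`_i \in s by rewrite mem_nth ?sN.
  by case/flattenP => ? /mapP[l _ ->] /nseqP[-> _]; rewrite mem_tnth.
have -> : kappa l = count_mem (tnth x l) s.
  rewrite count_flatten -map_comp sumnE big_map big_enum /= (bigD1 l) //=.
  rewrite count_nseq /= eqxx mul1n big1 ?addn0// => j jl.
  rewrite count_nseq /=; case: eqP => [/eqP|//].
  by rewrite !(tnth_nth 0) nth_uniq ?size_tuple// (inj_eq val_inj) (negPf jl).
rewrite -sum1_count (big_nth 0) sN big_mkord -sum1_card.
by apply: eq_bigl => i; rewrite inE mxE.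
Qed.

(* Main.v *)
Require Import Defs.
From mathcomp Require Import all_boot all_order all_algebra all_fingroup finmap.
From mathcomp Require Import all_classical all_reals all_analysis.
From mathcomp Require Import ring lra.
Set Implicit Arguments.
Unset Strict Implicit.
Unset Printing Implicit Defensive.
Import Order.TTheory GRing.Theory Num.Theory.
Import numFieldNormedType.Exports.
Local Open Scope ring_scope.

(** The proof is an entropy-method proof of a two-set inequality.  Write [D] for
the diameter of the alphabet and [P] for the uniform law on the multislice.  For
a compact convex set [K] inside the cube spanned by the alphabet, let [h] be the
squared Euclidean distance to [K].  The heart of the matter is that
[E exp(h / (68 D^2)) * P(K) <= 1]; for [B] a set of words at distance at least
[r] from [K] this gives [P(K) * P(B) <= exp(- r^2 / (68 D^2))]
([two_set_inequality]).  Taking for [K] the part of a sublevel set [f <= c] that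
lies in the cube, and for [B] the superlevel set [f >= c + t], whose points are
at distance at least [t / Lambda] from [K], yields [level_gap].  With [c = m] and
with [c = m - t], one of the two sets has probability at least one half by the
definition of a median, so each tail is at most [2 exp(- t^2 / (68 ...))]; since
68 is less than 144 there is room to spare.

The bound on [h] has three ingredients.

- A modified logarithmic Sobolev inequality for the symmetric group
  ([transposition_mlsi]): the entropy of a positive function [g] on a transitive
  set is at most the mean of [(g - g') (ln g - ln g')], summed over all ordered
  pairs of positions and divided by [2 N], where [g'] is [g] after the exchange of
  the two positions.  It is proved by induction, averaging [g] over the
  permutations of a growing set [B] of positions.  One step releases one more
  position [b]; the loss of entropy in this step is bounded by the tangent line
  of [x ln x] and reversibility, and then one averages over the choice of [b].

- Self-bounding.  Convexity makes [h] lie above its tangents, with gradient twice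
  [u = x - (nearest point of K)].  Exchanging positions [k] and [l] thus decreases
  [h] by at most [2 (u_k - u_l) (x_k - x_l)], whose squares add up to at most
  [8 N D^2 h]; as [K] lies in the cube, each decrease is also at most [4 D^2].
  Hence the entropy of [exp(l h)] is at most a multiple of
  [l^2 E (h exp(l h))], also for [l] down to [- 1 / (4 D^2)] ([self_bounding_ent]).

- Herbst's argument on both sides of the origin ([herbst_two_sided]): the entropy
  bound, with constant [C], says that [(1/l - C) ln E exp(l h)] is nonincreasing
  in [l] on either side of 0, and comparing a positive [l] with a negative one bounds [E exp(b h) * E exp(- a h)] by 1.  The
  second factor is at least the probability that [h = 0], i.e. [P(K)]. *)

Lemma eq_ler (R : numDomainType) (a b : R) : a = b -> a <= b.
Proof. by move->. Qed.

(** * The Jeffreys divergence *)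

Section jeffreys.
Context {R : realType}.
Implicit Types a b : R.

(** The summand of the symmetrised Kullback-Leibler divergence. *)
Definition jeffreys a b : R := (a - b) * (ln a - ln b).

(** The convex function [x ln x] lies above its tangents; after cancellation this
is what remains. *)
Lemma mulr_ln_sub_le a b : 0 < a -> 0 < b -> b * (ln a - ln b) <= a - b.
Proof.
move=> a0 b0; rewrite -ln_div ?posrE// mulrC -ler_pdivlMr// mulrBl divff ?gt_eqF//.
have := @le_ln1Dx R (a / b - 1); rewrite addrCA subrr addr0; apply.
by rewrite ltrBrDl subrr divr_gt0.
Qed.

Lemma jeffreys_ge0 a b : 0 < a -> 0 < b -> 0 <= jeffreys a b.
Proof.
move=> a0 b0; rewrite /jeffreys; have [ab|/ltW ba] := leP a b.
- by rewrite mulr_le0// subr_le0// ler_ln.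
- by rewrite mulr_ge0// subr_ge0// ler_ln.
Qed.

Lemma jeffreysZ c a b : 0 < c -> 0 < a -> 0 < b ->
  jeffreys (c * a) (c * b) = c * jeffreys a b.
Proof.
by move=> c0 a0 b0; rewrite /jeffreys !lnM ?posrE//; ring.
Qed.

Lemma sumr_pos (I : finType) (P : {set I}) (w : I -> R) :
  (0 < #|P|)%N -> (forall i, 0 < w i) -> 0 < \sum_(i in P) w i.
Proof.
move=> /card_gt0P[i iP] w0.
by rewrite (bigD1 i)//= ltr_pwDl// sumr_ge0// => j _; exact: ltW.
Qed.

(** Sum the tangent inequality for each [u i] against [v i] rescaled to the same
total mass: the linear terms cancel. *)
Lemma log_sum (I : finType) (P : {set I}) (u v : I -> R) :
  (0 < #|P|)%N -> (forall i, 0 < u i) -> (forall i, 0 < v i) ->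
  (\sum_(i in P) u i) * (ln (\sum_(i in P) u i) - ln (\sum_(i in P) v i)) <=
  \sum_(i in P) u i * (ln (u i) - ln (v i)).
Proof.
move=> P0 u0 v0; set A := \sum_(i in P) u i; set B := \sum_(i in P) v i.
have A0 : 0 < A by exact: sumr_pos.
have B0 : 0 < B by exact: sumr_pos.
rewrite -subr_ge0 mulr_suml -sumrB.
apply: (@le_trans _ _ (\sum_(i in P) (u i - A / B * v i))).
  by rewrite sumrB -mulr_sumr mulfVK ?gt_eqF// subrr.
apply: ler_sum => i _.
have := @mulr_ln_sub_le (A / B * v i) (u i) _ (u0 i).
rewrite mulr_gt0 ?divr_gt0// => /(_ isT).
rewrite lnM ?posrE ?divr_gt0// ln_div ?posrE// => h.
by move: h; lra.
Qed.

(** Joint convexity of [jeffreys]: it is the sum of two relative entropies, each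
covered by the log-sum inequality. *)
Lemma jeffreys_avg (I : finType) (P : {set I}) (u v : I -> R) :
  (0 < #|P|)%N -> (forall i, 0 < u i) -> (forall i, 0 < v i) ->
  jeffreys ((\sum_(i in P) u i) / #|P|%:R) ((\sum_(i in P) v i) / #|P|%:R) <=
  (\sum_(i in P) jeffreys (u i) (v i)) / #|P|%:R.
Proof.
move=> P0 u0 v0.
rewrite ![_ / #|P|%:R]mulrC jeffreysZ ?invr_gt0 ?ltr0n ?sumr_pos//.
rewrite ler_pM2l ?invr_gt0 ?ltr0n//.
have := lerD (log_sum P0 u0 v0) (log_sum P0 v0 u0); rewrite -big_split/=.
rewrite /jeffreys => h; apply: (le_trans (le_trans _ h)).
  by apply: eq_ler; ring.
by apply: ler_sum => i _; apply: eq_ler; ring.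
Qed.

End jeffreys.

(** * A modified logarithmic Sobolev inequality for transpositions *)

Section mlsi.
Context {R : realType} (I T : finType) (to : {action {perm I} &-> T}) (S : {set T}).
Hypothesis acts_S : [acts [set: {perm I}]%SET, on S | to].
Implicit Types (B : {set I}) (g : T -> R).

Definition sym_avg B g (t : T) : R :=
  (\sum_(s in Sym B) g (to t s)) / #|Sym B|%:R.

Definition ent_energy g (k l : I) : R :=
  \sum_(t in S) jeffreys (g t) (g (to t (tperm k l))).

Lemma sum_act F (s : {perm I}) : \sum_(t in S) F (to t s) = \sum_(t in S) F t :> R.
Proof. by rewrite [RHS](reindex_acts to acts_S (finset.in_setT s)). Qed.

Lemma card_Sym_gt0 B : (0 < #|Sym B|)%N.
Proof. by rewrite card_Sym fact_gt0. Qed.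

Lemma sym_avg_gt0 B g : (forall t, 0 < g t) -> forall t, 0 < sym_avg B g t.
Proof.
move=> g0 t; rewrite divr_gt0 ?ltr0n ?card_Sym_gt0//.
by rewrite sumr_pos ?card_Sym_gt0.
Qed.

(** The coset decomposition of [Sym B] over the stabiliser of [b]: the coset is
determined by the position [c] that is sent to [b], and [tperm b c] represents it. *)
Lemma Sym_tperm_mul B b c s : b \in B -> c \in B ->
  ((tperm b c * s)%g \in Sym B) && (((tperm b c * s)^-1)%g b == c) =
  (s \in Sym (B :\ b)).
Proof.
move=> bB cB.
have -> : (((tperm b c * s)^-1)%g b == c) = (s b == b).
  by rewrite -(inj_eq (@perm_inj _ (tperm b c * s)%g)) permKV permM tpermR eq_sym.
rewrite !inE; apply/andP/fintype.subsetP => [[/fintype.subsetP sB /eqP sb] x|sB].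
  rewrite !inE => sx.
  have xb : x != b by apply: contra_neq sx => ->.
  rewrite xb/=; have := sB (tperm b c x); rewrite !inE permM tpermK.
  have [->|xc] := eqVneq x c; first by [].
  have -> : tperm b c x = x by rewrite tpermD// eq_sym.
  by move=> /(_ sx).
have sb : s b = b.
  by apply/eqP/negPn/negP => sb; have := sB b; rewrite !inE => /(_ sb); rewrite eqxx.
split; last by rewrite sb.
apply/fintype.subsetP => x; rewrite !inE permM; apply: contraR => xB.
have xb : b != x by apply: contraNneq xB => <-.
have xc : c != x by apply: contraNneq xB => <-.
rewrite tpermD//; apply/negPn/negP => sx; have := sB x; rewrite !inE => /(_ sx).
by rewrite (negPf xB) andbF.
Qed.

Lemma sym_avgD1 B b g t : b \in B ->
  sym_avg B g t = (\sum_(c in B) sym_avg (B :\ b) g (to t (tperm b c))) / #|B|%:R.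
Proof.
move=> bB; rewrite /sym_avg -mulr_suml -mulrA -invfM -natrM.
have -> : (#|Sym (B :\ b)| * #|B| = #|Sym B|)%N.
  by rewrite !card_Sym (cardsD1 b B) bB add1n factS mulnC.
congr (_ / _); rewrite (partition_big (fun s : {perm I} => (s^-1)%g b) (mem B))/=; last first.
  move=> s; rewrite inE => sB; have := perm_closed ((s^-1)%g b) sB.
  by rewrite permKV bB => <-.
apply: eq_bigr => c cB.
rewrite (reindex_inj (mulgI (tperm b c)))/=.
apply: eq_big => [s|s _]; first exact: Sym_tperm_mul.
by rewrite actM.
Qed.

(** Averaging does not increase the energy.  Conjugating by a permutation [s] that
fixes [b] turns the exchange of [b] and [c] into that of [b] and [s c], so the
averages before and after an exchange can be paired term by term, which makes
[jeffreys_avg] applicable; the sum over [c] absorbs [s]. *)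
Lemma sym_energy_avg B b g : b \in B -> (forall t, 0 < g t) ->
  \sum_(c in B) ent_energy (sym_avg (B :\ b) g) b c <= \sum_(c in B) ent_energy g b c.
Proof.
move=> bB g0; set m : R := #|Sym (B :\ b)|%:R.
have m0 : 0 < m by rewrite ltr0n card_Sym_gt0.
apply: (@le_trans _ _ (\sum_(c in B) \sum_(t in S) (\sum_(s in Sym (B :\ b))
    jeffreys (g (to t s)) (g (to (to t s) (tperm b (s c))))) / m)).
  apply: ler_sum => c cB; apply: ler_sum => t tS.
  apply: le_trans (jeffreys_avg (card_Sym_gt0 _) _ _) _ => //.
  rewrite ler_pM2r ?invr_gt0//; apply: ler_sum => s sB.
  apply: eq_ler; congr (jeffreys _ (g _)).
  rewrite -!actM; congr (to t _).
  have sb : s b = b.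
    apply/eqP/negPn/negP => sb; move: sB; rewrite inE => /fintype.subsetP/(_ b).
    by rewrite !inE sb eqxx => /(_ isT).
  have -> : tperm b (s c) = (tperm b c ^ s)%g by rewrite tpermJ sb.
  exact: conjgC.
rewrite (eq_bigr (fun c => \sum_(s in Sym (B :\ b)) (ent_energy g b (s c)) / m)).
  rewrite exchange_big/= (eq_bigr (fun=> (\sum_(c in B) ent_energy g b c) / m)).
    by rewrite sumr_const -mulr_natr -mulrA mulVf ?mulr1// gt_eqF.
  move=> s sB; rewrite -mulr_suml [in RHS](reindex_inj (@perm_inj _ s)).
  congr (_ / m); apply: eq_bigl => c.
  have sB' : perm_on B s.
    by move: (sB); rewrite inE => /fintype.subset_trans; apply; exact: subD1set.
  by rewrite (perm_closed c sB').
move=> c cB; rewrite -mulr_suml -mulr_suml exchange_big/=; congr (_ / m).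
by apply: eq_bigr => s _; rewrite (sum_act (fun t => jeffreys (g t) (g (to t (tperm b (s c)))))).
Qed.

(** Releasing the position [b].  The tangent line of [x ln x] at [G] bounds the
entropy lost by a covariance of [G] and [ln G] across the exchanges of [b], and by
reversibility this covariance is half of an energy. *)
Lemma xlnx_step B b g : b \in B -> (forall t, 0 < g t) ->
  \sum_(t in S) sym_avg (B :\ b) g t * ln (sym_avg (B :\ b) g t)
  - \sum_(t in S) sym_avg B g t * ln (sym_avg B g t) <=
  (\sum_(c in B) ent_energy g b c) / (2 * #|B|%:R).
Proof.
move=> bB g0; set G := sym_avg (B :\ b) g.
have G0 : forall t, 0 < G t by exact: sym_avg_gt0.
have n0 : 0 < #|B|%:R :> R by rewrite ltr0n; apply/card_gt0P; exists b.
apply: (@le_trans _ _ ((\sum_(c in B) ent_energy G b c) / (2 * #|B|%:R))); last first.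
  by rewrite ler_pM2r ?invr_gt0 ?mulr_gt0//; exact: sym_energy_avg.
apply: (@le_trans _ _ (\sum_(t in S) (ln (G t) + 1) * (G t - sym_avg B g t))).
  rewrite -sumrB; apply: ler_sum => t _.
  have := mulr_ln_sub_le (G0 t) (sym_avg_gt0 B g0 t).
  by move: (G t) (sym_avg B g t) => x y; lra.
(* Substituting [to t (tperm b c)] for [t] and averaging the two expressions
   symmetrises the summand. *)
have half c : \sum_(t in S) (ln (G t) + 1) * (G t - G (to t (tperm b c))) =
    ent_energy G b c / 2.
  set x := LHS.
  have E : x = \sum_(t in S) (ln (G (to t (tperm b c))) + 1) *
      (G (to t (tperm b c)) - G t).
    rewrite /x -(sum_act _ (tperm b c)); apply: eq_bigr => t _.
    by rewrite -actM tperm2 act1.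
  have : x + x = ent_energy G b c.
    rewrite {2}E /x -big_split/=; apply: eq_bigr => t _; rewrite /jeffreys; ring.
  by move=> <-; field.
rewrite (eq_bigr (fun t => (\sum_(c in B) (ln (G t) + 1) *
   (G t - G (to t (tperm b c)))) / #|B|%:R)); last first.
  move=> t _; rewrite (sym_avgD1 _ _ bB) -mulr_sumr sumrB sumr_const -mulr_natr.
  by rewrite -/G; field; rewrite gt_eqF.
rewrite -mulr_suml exchange_big/= (eq_bigr _ (fun c _ => half c)) -mulr_suml.
by apply: eq_ler; field; rewrite gt_eqF.
Qed.

(** Each pair of distinct positions survives the removal of [b] for all but two
choices of [b], and the diagonal terms vanish. *)
Lemma sum_energy_pairs B g :
  \sum_(b in B) \sum_(k in B :\ b) \sum_(l in B :\ b) ent_energy g k l =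
  (#|B|%:R - 2) * \sum_(k in B) \sum_(l in B) ent_energy g k l.
Proof.
have diag k : ent_energy g k k = 0.
  by rewrite /ent_energy big1// => t _; rewrite tperm1 act1 /jeffreys subrr mul0r.
have sym k l : ent_energy g k l = ent_energy g l k by rewrite /ent_energy tpermC.
set Q := \sum_(k in B) \sum_(l in B) ent_energy g k l.
have E b : b \in B -> \sum_(k in B :\ b) \sum_(l in B :\ b) ent_energy g k l =
    Q - 2 * \sum_(l in B) ent_energy g b l.
  move=> bB.
  have row k : \sum_(l in B) ent_energy g k l =
      ent_energy g k b + \sum_(l in B :\ b) ent_energy g k l.
    by rewrite (big_setD1 b).
  have -> : Q = \sum_(l in B) ent_energy g b l +
      \sum_(k in B :\ b) \sum_(l in B) ent_energy g k l by rewrite /Q (big_setD1 b).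
  under [X in _ + X - _]eq_bigr => k _ do rewrite row.
  rewrite big_split/=.
  have -> : \sum_(k in B :\ b) ent_energy g k b = \sum_(l in B) ent_energy g b l.
    by rewrite row diag add0r; apply: eq_bigr => k _; rewrite sym.
  ring.
rewrite (eq_bigr _ E) sumrB -mulr_sumr -/Q sumr_const -mulr_natl; ring.
Qed.

(** Induction on the size [m] of [B]: apply the step with each [b] in [B] and
average over [b].  The constant is reproduced because [(m - 2) / (m - 1) + 1 / m <= 1]. *)
Lemma sym_ent_le B g : (forall t, 0 < g t) ->
  \sum_(t in S) g t * ln (g t) - \sum_(t in S) sym_avg B g t * ln (sym_avg B g t)
  <= (\sum_(k in B) \sum_(l in B) ent_energy g k l) / (2 * #|B|%:R).
Proof.
move=> g0; have [n] := ubnP #|B|; elim: n => // n IH in B *; rewrite ltnS => Bn.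
set Q := \sum_(k in B) \sum_(l in B) ent_energy g k l.
have Q0 : 0 <= Q.
  by do 3 (apply: sumr_ge0 => ? _); exact: jeffreys_ge0.
have [B1|B1] := leqP #|B| 1.
  have avgE t : sym_avg B g t = g t.
    have S1 : Sym B = [set 1%g]%SET.
      apply/eqP; rewrite eq_sym eqEcard cards1 card_Sym.
      have -> : (#|B|)`! = 1%N by case: #|B| B1 => [|[]].
      by rewrite leqnn andbT finset.sub1set inE perm_on1.
    by rewrite /sym_avg S1 big_set1 cards1 act1 divr1.
  rewrite (eq_bigr (fun t => g t * ln (g t)) (P := fun t => t \in S)
    (F1 := fun t => sym_avg B g t * ln (sym_avg B g t))); last by move=> t _; rewrite avgE.
  by rewrite subrr divr_ge0// mulr_ge0.
set m : R := #|B|%:R; have m1 : 1 < m by rewrite ltr1n.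
set X := (X in X <= _).
have step b : b \in B -> X <=
    (\sum_(k in B :\ b) \sum_(l in B :\ b) ent_energy g k l) / (2 * (m - 1)) +
    (\sum_(c in B) ent_energy g b c) / (2 * m).
  move=> bB.
  have cB : #|B| = #|B :\ b|.+1 by rewrite (cardsD1 b) bB.
  have /IH : (#|B :\ b| < n)%N by rewrite -cB.
  have -> : #|B :\ b|%:R = m - 1 :> R by rewrite /m cB -natr1 addrK.
  move=> h; have := lerD h (xlnx_step bB g0); rewrite -/m.
  by apply: le_trans; rewrite /X addrA subrK.
have : \sum_(b in B) X <= \sum_(b in B)
    ((\sum_(k in B :\ b) \sum_(l in B :\ b) ent_energy g k l) / (2 * (m - 1)) +
    (\sum_(c in B) ent_energy g b c) / (2 * m)) by exact: ler_sum.
rewrite sumr_const -[X *+ _]mulr_natl big_split/= -!mulr_suml sum_energy_pairs -/m -/Q => h.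
have m0 : 0 < m by lra.
have mm : 0 < m - 1 by lra.
rewrite -(ler_pM2l m0); apply: (le_trans h).
have -> : m * (Q / (2 * m)) = Q / 2 by field; rewrite gt_eqF.
rewrite -subr_ge0.
have -> : Q / 2 - ((m - 2) * Q / (2 * (m - 1)) + Q / (2 * m)) =
   Q / (2 * m * (m - 1)).
  by field; rewrite !gt_eqF.
by rewrite divr_ge0// !mulr_ge0// ltW.
Qed.

End mlsi.

(** For [B] the whole set of positions, the average of [g] is a constant on the
orbit [S], hence equal to the mean of [g] over [S]. *)
Theorem transposition_mlsi (R : realType) (I T : finType)
    (to : {action {perm I} &-> T}) (S : {set T}) (g : T -> R) :
  [transitive [set: {perm I}]%SET, on S | to] -> (forall t, 0 < g t) ->
  \sum_(t in S) g t * ln (g t)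
    - (\sum_(t in S) g t) * ln ((\sum_(t in S) g t) / #|S|%:R)
  <= (\sum_k \sum_l ent_energy to S g k l) / (2 * #|I|%:R).
Proof.
move=> trS g0; have actS := atrans_acts trS; set Z := \sum_(t in S) g t.
have [t0 t0S] : exists t, t \in S.
  by have [t tS _] := imsetP trS; exists t.
have S0 : #|S|%:R != 0 :> R by rewrite pnatr_eq0 -lt0n; apply/card_gt0P; exists t0.
have SymT : Sym [set: I]%SET = [set: {perm I}]%SET.
  by apply/finset.setP => u; rewrite !inE; apply/fintype.subsetP => i; rewrite inE.
have avgC t : t \in S -> sym_avg to [set: I]%SET g t = sym_avg to [set: I]%SET g t0.
  move=> tS; have [s _ ->] := atransP2 trS t0S tS.
  rewrite /sym_avg SymT; congr (_ / _).
  rewrite [RHS](reindex_inj (mulgI s)); apply: eq_big => [u|u _].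
    by rewrite !inE.
  by rewrite actM.
have sum_avg : \sum_(t in S) sym_avg to [set: I]%SET g t = Z.
  rewrite -mulr_suml exchange_big/= (eq_bigr _ (fun s _ => sum_act actS g s)).
  by rewrite sumr_const -[X in X / _]mulr_natr mulfK// pnatr_eq0 -lt0n card_Sym_gt0.
have avgE : sym_avg to [set: I]%SET g t0 = Z / #|S|%:R.
  by rewrite -sum_avg (eq_bigr _ avgC) sumr_const -[X in X / _]mulr_natr mulfK.
have := sym_ent_le actS [set: I]%SET g0.
rewrite (eq_bigr (fun t => sym_avg to [set: I]%SET g t * ln (Z / #|S|%:R)) (P := fun t => t \in S)
   (F1 := fun t => sym_avg to [set: I]%SET g t * ln (sym_avg to [set: I]%SET g t))); last first.
  by move=> t tS; rewrite [in X in ln X]avgC// avgE.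
rewrite -mulr_suml sum_avg cardsT => /le_trans; apply.
apply: eq_ler; congr (_ / _).
by apply: eq_big => [k|k _]; rewrite ?inE//; apply: eq_bigl => l; rewrite inE.
Qed.

(** * Herbst's argument on both sides of the origin *)

Section herbst.
Context {R : realType} (T : finType) (S : {set T}) (h : T -> R).
Hypothesis S0 : (0 < #|S|)%N.
Hypothesis h0 : forall t, 0 <= h t.

Definition mgf (l : R) : R := (\sum_(t in S) expR (l * h t)) / #|S|%:R.
Definition dmgf (l : R) : R := (\sum_(t in S) h t * expR (l * h t)) / #|S|%:R.

Let n0 : 0 < #|S|%:R :> R. Proof. by rewrite ltr0n. Qed.

Lemma mgf_gt0 l : 0 < mgf l.
Proof.
by rewrite divr_gt0// sumr_pos// => t; exact: expR_gt0.
Qed.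

Lemma avg_const (c : R) : (\sum_(t in S) c) / #|S|%:R = c.
Proof. by rewrite sumr_const -[X in X / _]mulr_natr mulfK// gt_eqF. Qed.

Lemma is_derive_mgf (l : R) : is_derive l 1 mgf (dmgf l).
Proof.
have E : mgf = (#|S|%:R^-1 : R) \*:
    \sum_(i < #|S|) (fun x : R => expR (x * h (enum_val i))).
  apply/funext => x; rewrite /mgf big_enum_val/= mulrC.
  by rewrite fct_sumE.
rewrite E; apply: is_derive_eq.
rewrite /dmgf [in RHS]big_enum_val/= -[_ *: _]/(_ * _) mulrC; congr (_ * _).
by apply: eq_bigr => i _; rewrite scaler0 add0r -[_%:A]/(_ * 1) mulr1 mulrC.
Qed.

(** The entropy bound with constant [K] is precisely a differential inequality
saying that this function has nonpositive derivative. *)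
Definition herbst_fun (K l : R) := (l^-1 - K) * ln (mgf l).

Lemma is_derive_herbst_fun K (l : R) : l != 0 ->
  is_derive l 1 (herbst_fun K)
    ((l^-1 - K) * (dmgf l / mgf l) - l ^- 2 * ln (mgf l)).
Proof.
move=> l0.
have dln : is_derive l 1 (fun x => ln (mgf x)) ((mgf l)^-1 * dmgf l).
  apply: is_derive1_comp; [exact/is_derive1_ln/mgf_gt0|exact: is_derive_mgf].
have dinv : is_derive l 1 (fun x : R => x^-1 - K) (- l ^- 2).
  apply: is_derive_eq; first by apply: is_deriveB; apply: is_deriveV.
  by rewrite subr0 -[_ *: _]/(_ * _) mulr1.
apply: (is_derive_eq (is_deriveM dinv dln)).
by rewrite -[_ *: _]/(_ * _) -[X in _ + X]/(_ * _); ring.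
Qed.

Lemma herbst_fun_nonincr K (a b : R) : a <= b -> 0 < a \/ b < 0 ->
  (forall l, a <= l <= b ->
     l * dmgf l - mgf l * ln (mgf l) <= K * l ^+ 2 * dmgf l) ->
  herbst_fun K b <= herbst_fun K a.
Proof.
move=> ab ab0 ent.
have nz l : a <= l <= b -> l != 0.
  by move=> /andP[al lb]; case: ab0 => ?; [rewrite gt_eqF//; lra|rewrite lt_eqF//; lra].
have inab l : l \in `]a, b[ -> a <= l <= b.
  by rewrite in_itv/= => /andP[/ltW-> /ltW->].
apply: (@ler0_derive1_le_cc _ (herbst_fun K) a b) => //.
- by move=> l /inab /nz/(is_derive_herbst_fun K)[].
- move=> l /inab lab; have l0 := nz _ lab; rewrite derive1E.
  have [_ ->] := is_derive_herbst_fun K l0.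
  have Z0 := mgf_gt0 l; have := ent _ lab.
  move: (mgf l) (dmgf l) (ln _) Z0 => Z Z' Y Z0 e.
  have l20 : 0 < l ^+ 2 by rewrite exprn_even_gt0.
  rewrite -(pmulr_rle0 _ (mulr_gt0 l20 Z0)).
  have -> : l ^+ 2 * Z * ((l^-1 - K) * (Z' / Z) - l ^- 2 * Y) =
      l * Z' - K * l ^+ 2 * Z' - Z * Y.
    by field; rewrite l0 gt_eqF.
  by lra.
- apply: continuous_in_subspaceT => l; rewrite inE/= in_itv/= => lab.
  apply: differentiable_continuous; apply/derivable1_diffP.
  by have [] := is_derive_herbst_fun K (nz _ lab).
- by rewrite in_itv/= ab lexx.
- by rewrite in_itv/= ab lexx.
Qed.

(** The first-order terms in [e] cancel: this is what lets the two monotone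
branches of [herbst_fun] be joined across the singularity at 0. *)
Lemma mgf_pm_le e : 0 <= e <= 1 ->
  mgf e + mgf (- e) - 2 <= e ^+ 2 * ((\sum_(t in S) h t ^+ 2 * expR (h t)) / #|S|%:R).
Proof.
move=> /andP[e0 e1].
rewrite -[X in _ - X](avg_const 2) -mulrDl -mulrBl -big_split/= -sumrB mulrA mulr_sumr.
rewrite ler_pM2r ?invr_gt0//; apply: ler_sum => t _.
set x := e * h t; have x0 : 0 <= x by rewrite mulr_ge0.
rewrite mulNr -/x mulrA -exprMn -/x.
have -> : expR x + expR (- x) - 2 = (expR x - 1) * (1 - expR (- x)).
  by rewrite mulrBl !mulrBr mulr1 mul1r expRxMexpNx_1; ring.
rewrite expr2 mulrAC; apply: ler_pM.
- by rewrite subr_ge0 -expR0 ler_expR.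
- by rewrite subr_ge0 -expR0 ler_expR oppr_le0.
- apply: (@le_trans _ _ (x * expR x)).
    rewrite -{2}[expR x]opprK -subr_ge0.
    have -> : x * - - expR x - (expR x - 1) = expR x * (expR (- x) - (1 - x)).
      by rewrite mulrBr expRxMexpNx_1; ring.
    by rewrite mulr_ge0 ?expR_ge0// subr_ge0 expR_ge1Dx.
  by rewrite ler_wpM2l// ler_expR ler_piMl.
- by have := expR_ge1Dx (- x); lra.
Qed.

(** By monotonicity on either side of 0 the value of [herbst_fun] at [b] is at most
its value at a small [e], and its value at [- e] at most that at [- a]; the values at
[e] and [- e] differ by at most a quantity of order [e].  The relation between [a],
[b] and [K] gives [ln (mgf b)] and [ln (mgf (- a))] opposite coefficients at the two
ends, so the comparison bounds their sum. *)
Theorem herbst_two_sided K a b : 0 <= K -> 0 < a -> 0 < b ->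
  b^-1 = a^-1 + 2 * K ->
  (forall l, - a <= l <= b ->
     l * dmgf l - mgf l * ln (mgf l) <= K * l ^+ 2 * dmgf l) ->
  mgf b * mgf (- a) <= 1.
Proof.
move=> K0 a0 b0 ab ent.
set c := a^-1 + K; have c0 : 0 < c by rewrite ltr_wpDr ?invr_gt0.
set C := (\sum_(t in S) h t ^+ 2 * expR (h t)) / #|S|%:R.
have C0 : 0 <= C.
  by rewrite divr_ge0// sumr_ge0// => t _; rewrite mulr_ge0 ?expR_ge0// sqr_ge0.
have ln_le x : 0 < x -> ln x <= x - 1 :> R.
  by move=> x0; rewrite -{1}[x](subrK 1) addrC le_ln1Dx//; lra.
set X := ln (mgf b) + ln (mgf (- a)).
have key e : 0 < e -> e <= 1 -> e <= a -> e <= b -> c * X <= e * C.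
  move=> e0 e1 ea eb.
  have Gb : herbst_fun K b <= herbst_fun K e.
    by apply: herbst_fun_nonincr => //; [left|move=> l ?; apply: ent; lra].
  have Ga : herbst_fun K (- e) <= herbst_fun K (- a).
    apply: herbst_fun_nonincr; first by rewrite lerN2.
      by right; rewrite oppr_lt0.
    by move=> l ?; apply: ent; lra.
  have Ye : 0 <= ln (mgf e).
    rewrite ln_ge0// -[leLHS](avg_const 1) ler_pM2r ?invr_gt0//.
    by apply: ler_sum => t _; rewrite -expR0 ler_expR mulr_ge0// ltW.
  have YNe : ln (mgf (- e)) <= 0.
    rewrite ln_le0// -[leRHS](avg_const 1) ler_pM2r ?invr_gt0//.
    by apply: ler_sum => t _; rewrite -expR0 ler_expR mulNr oppr_le0 mulr_ge0// ltW.
  have h1 : e * herbst_fun K e <= ln (mgf e).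
    rewrite /herbst_fun mulrA mulrBr mulfV ?gt_eqF// ler_piMl//.
    by rewrite gerBl mulr_ge0// ltW.
  have h2 : - (e * herbst_fun K (- e)) <= ln (mgf (- e)).
    rewrite /herbst_fun invrN.
    have -> : - (e * ((- e^-1 - K) * ln (mgf (- e)))) =
        ln (mgf (- e)) + e * K * ln (mgf (- e)) by field; rewrite gt_eqF.
    by rewrite gerDl mulr_ge0_le0// mulr_ge0// ltW.
  have h3 : mgf e + mgf (- e) - 2 <= e ^+ 2 * C by apply: mgf_pm_le; rewrite e1 ltW.
  have h4 := ln_le _ (mgf_gt0 e); have h5 := ln_le _ (mgf_gt0 (- e)).
  have h6 : c * X = herbst_fun K b - herbst_fun K (- a).
    rewrite /herbst_fun invrN ab /X /c; ring.
  rewrite -(ler_pM2l e0) [e * (e * C)]mulrA -expr2 h6.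
  have h7 : e * (herbst_fun K b - herbst_fun K (- a)) <=
      e * (herbst_fun K e - herbst_fun K (- e)).
    by rewrite ler_pM2l//; lra.
  apply: (le_trans h7); rewrite mulrBr; lra.
have X0 : X <= 0.
  rewrite leNgt; apply/negP => X0.
  have cX : 0 < c * X by rewrite mulr_gt0.
  pose d := c * X / (2 * (C + 1)).
  have d0 : 0 < d by rewrite divr_gt0// mulr_gt0//; lra.
  pose e := Num.min (Num.min 1 d) (Num.min a b).
  have e0 : 0 < e by rewrite !lt_min ltr01 d0 a0 b0.
  have := key e e0; rewrite !ge_min !lexx/= !orbT => /(_ isT isT isT).
  apply/negP; rewrite -ltNge.
  have : e * C <= d * C by rewrite ler_wpM2r// !ge_min lexx orbT.
  move=> /le_lt_trans; apply.
  rewrite /d mulrAC ltr_pdivrMr; last by rewrite mulr_gt0//; lra.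
  by rewrite ltr_pM2l//; lra.
have Zb := mgf_gt0 b; have Za := mgf_gt0 (- a).
move: X0; rewrite /X -lnM ?posrE// => X0.
rewrite -[leLHS]lnK ?posrE; last exact: mulr_gt0.
by rewrite -expR0 ler_expR.
Qed.

End herbst.

(** * Self-bounding functions *)

Section self_bounding.
Context {R : realType}.

Definition ppart (x : R) : R := Num.max 0 x.

Lemma jeffreys_expR_sym (v l a b : R) : 0 < v -> - v^-1 <= l ->
  b <= a -> a - b <= v ->
  jeffreys (expR (l * a)) (expR (l * b)) <= 4 * l ^+ 2 * ((a - b) ^+ 2 * expR (l * a)).
Proof.
move=> v0 lv ba abv; rewrite /jeffreys !expRK.
have e4 : expR 1 <= 4 :> R.
  have -> : 1 = 2^-1 + 2^-1 :> R by field.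
  have e2 : expR (2^-1) <= 2 :> R.
    rewrite -[leLHS]invrK -expRN -[leRHS]invrK lef_pV2 ?posrE ?expR_gt0//.
    by have := @expR_ge1Dx R (- 2^-1); lra.
  rewrite expRD; apply: (@le_trans _ _ (2 * 2)); last by lra.
  by rewrite ler_pM ?expR_ge0.
(* Whichever exponent is larger, the larger exponential is at most
   [4 * expR (l * a)], since [l * (b - a) <= 1]. *)
have b4 : expR (l * b) <= 4 * expR (l * a).
  have -> : l * b = l * (b - a) + l * a by ring.
  rewrite expRD ler_pM2r ?expR_gt0//; apply: le_trans e4; rewrite ler_expR.
  have : (l + v^-1) * (b - a) <= 0 by rewrite mulr_ge0_le0//; lra.
  have : v^-1 * (a - b) <= 1 by rewrite mulrC ler_pdivrMr// mul1r.
  lra.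
have step (x y : R) : expR x - expR y <= expR x * (x - y).
  have -> : expR y = expR x * expR (y - x) by rewrite -expRD addrC subrK.
  rewrite -{1}[expR x]mulr1 -mulrBr ler_pM2l ?expR_gt0//.
  by have := expR_ge1Dx (y - x); lra.
have E0 := expR_gt0 (l * a).
have S0 : 0 <= (l * a - l * b) ^+ 2 by exact: sqr_ge0.
have -> : 4 * l ^+ 2 * ((a - b) ^+ 2 * expR (l * a)) =
  4 * expR (l * a) * (l * a - l * b) ^+ 2 by ring.
have [ab|/ltW ab] := leP (l * b) (l * a).
  apply: (@le_trans _ _ (expR (l * a) * (l * a - l * b) ^+ 2)).
    by rewrite expr2 mulrA ler_wpM2r ?subr_ge0.
  by rewrite ler_wpM2r//; lra.
apply: (@le_trans _ _ (expR (l * b) * (l * a - l * b) ^+ 2)).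
  rewrite -mulrNN !opprB.
  have -> : (l * a - l * b) ^+ 2 = (l * b - l * a) * (l * b - l * a) by ring.
  by rewrite mulrA ler_wpM2r ?subr_ge0.
by rewrite ler_wpM2r.
Qed.

(** The energy is charged to the endpoint where [h] is larger, although for
negative [l] the exponential is larger at the other one.  The two exponentials then
differ by a factor of at most [expR 1], whence the 4. *)
Lemma jeffreys_expR (v l a b : R) : 0 < v -> - v^-1 <= l -> `|a - b| <= v ->
  jeffreys (expR (l * a)) (expR (l * b)) <=
  4 * l ^+ 2 * (ppart (a - b) ^+ 2 * expR (l * a) + ppart (b - a) ^+ 2 * expR (l * b)).
Proof.
move=> v0 lv; rewrite ler_norml => /andP[vab abv].
rewrite /ppart; have [ba|/ltW ab] := leP b a.
  rewrite (max_r (x := 0)) ?subr_ge0// (max_l (x := 0)) ?subr_le0//.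
  by rewrite expr0n/= mul0r addr0; apply: jeffreys_expR_sym v0 _ _ _.
rewrite (max_l (x := 0)) ?subr_le0// (max_r (x := 0)) ?subr_ge0//.
rewrite expr0n/= mul0r add0r.
have -> : jeffreys (expR (l * a)) (expR (l * b)) =
  jeffreys (expR (l * b)) (expR (l * a)) by rewrite /jeffreys; ring.
by apply: jeffreys_expR_sym v0 _ _ _ => //; lra.
Qed.

Variables (I T : finType) (to : {action {perm I} &-> T}) (S : {set T}).
Hypothesis trS : [transitive [set: {perm I}]%SET, on S | to].
Hypothesis I0 : (0 < #|I|)%N.
Variables (h : T -> R) (v : R).
Hypothesis h0 : forall t, 0 <= h t.
Hypothesis v0 : 0 < v.
Hypothesis h_diff : forall t k l, t \in S -> h t - h (to t (tperm k l)) <= v.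
Hypothesis h_var : forall t, t \in S ->
  \sum_k \sum_l ppart (h t - h (to t (tperm k l))) ^+ 2 <= 2 * #|I|%:R * v * h t.

Let actS : [acts [set: {perm I}]%SET, on S | to]. Proof. exact: atrans_acts. Qed.

Lemma atrans_card_gt0 : (0 < #|S|)%N.
Proof. by apply/card_gt0P; have [t tS _] := imsetP trS; exists t. Qed.

(** Reversibility turns the increases of [h] along exchanges into decreases, so
that only the one-sided variation controlled by [h_var] enters. *)
Lemma self_bounding_ent l : - v^-1 <= l ->
  l * dmgf S h l - mgf S h l * ln (mgf S h l) <= 8 * v * l ^+ 2 * dmgf S h l.
Proof.
move=> lv; have S0 := atrans_card_gt0.
have n0 : 0 < #|S|%:R :> R by rewrite ltr0n.
have := transposition_mlsi trS (fun t => expR_gt0 (l * h t)) => mlsi.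
rewrite -(ler_pM2l n0) mulrBr.
have -> : #|S|%:R * (l * dmgf S h l) = \sum_(t in S) expR (l * h t) * ln (expR (l * h t)).
  rewrite /dmgf mulrCA [_%:R * _]mulrC mulfVK ?gt_eqF// mulr_sumr.
  by apply: eq_bigr => t _; rewrite expRK; ring.
rewrite mulrA [_%:R * mgf S h l]mulrC {1}/mgf mulfVK ?gt_eqF//.
apply: (le_trans mlsi); rewrite ler_pdivrMr ?mulr_gt0 ?ltr0n//.
have inS t s : t \in S -> to t s \in S.
  by move=> tS; rewrite (actsP actS) // inE.
have energy k k' : ent_energy to S (fun t => expR (l * h t)) k k' <=
    8 * l ^+ 2 * \sum_(t in S) ppart (h t - h (to t (tperm k k'))) ^+ 2 * expR (l * h t).
  apply: (@le_trans _ _ (\sum_(t in S) 4 * l ^+ 2 *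
      (ppart (h t - h (to t (tperm k k'))) ^+ 2 * expR (l * h t) +
       ppart (h (to t (tperm k k')) - h t) ^+ 2 * expR (l * h (to t (tperm k k')))))).
    apply: ler_sum => t tS; apply: jeffreys_expR v0 lv _.
    rewrite ler_norml h_diff// andbT lerNl opprB.
    have := h_diff k k' (inS t (tperm k k') tS).
    by rewrite -actM tperm2 act1.
  rewrite -mulr_sumr big_split/=.
  have -> : \sum_(t in S) ppart (h (to t (tperm k k')) - h t) ^+ 2 *
        expR (l * h (to t (tperm k k'))) =
      \sum_(t in S) ppart (h t - h (to t (tperm k k'))) ^+ 2 * expR (l * h t).
    rewrite -[RHS](sum_act actS _ (tperm k k')); apply: eq_bigr => t _.
    by rewrite -actM tperm2 act1.
  by apply: eq_ler; ring.
apply: (@le_trans _ _ (8 * l ^+ 2 * \sum_(t in S) (2 * #|I|%:R * v * h t) * expR (l * h t))).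
  rewrite (le_trans (ler_sum _ (fun k _ => ler_sum _ (fun k' _ => energy k k'))))//.
  rewrite (eq_bigr _ (fun k _ => esym (mulr_sumr _ _ _ _))) -mulr_sumr.
  have l20 : 0 <= 8 * l ^+ 2 by rewrite mulr_ge0// sqr_ge0.
  rewrite ler_wpM2l//.
  under eq_bigr do rewrite exchange_big/=.
  rewrite exchange_big/=; apply: ler_sum => t tS.
  under eq_bigr do rewrite -mulr_suml.
  rewrite -mulr_suml.
  by rewrite ler_pM2r ?expR_gt0// h_var.
apply: eq_ler.
rewrite /dmgf (eq_bigr (fun t => (2 * #|I|%:R * v) * (h t * expR (l * h t)))).
  by rewrite -mulr_sumr; field; rewrite gt_eqF.
by move=> t _; ring.
Qed.

(** [herbst_two_sided] with [K = 8 v] and [a = 1 / v], so that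
[1 / b = v + 16 v]. *)
Theorem self_bounding_mgf : mgf S h (17 * v)^-1 * mgf S h (- v^-1) <= 1.
Proof.
apply: (@herbst_two_sided _ _ _ _ atrans_card_gt0 h0 (8 * v)).
- by rewrite mulr_ge0// ltW.
- by rewrite invr_gt0.
- by rewrite invr_gt0 mulr_gt0.
- by rewrite !invrK; ring.
- by move=> l /andP[lv _]; exact: self_bounding_ent.
Qed.

End self_bounding.

(** * Squared distance to a compact convex set *)

Section projection.
Context {R : realType} (N : nat).
Implicit Types u v w x y : 'rV[R]_N.

Definition dotv u v : R := \sum_i u 0 i * v 0 i.

Lemma dotvC u v : dotv u v = dotv v u.
Proof. by apply: eq_bigr => i _; rewrite mulrC. Qed.

Lemma dotvDl u v w : dotv (u + v) w = dotv u w + dotv v w.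
Proof. by rewrite -big_split/=; apply: eq_bigr => i _; rewrite mxE mulrDl. Qed.

Lemma dotvZl c u v : dotv (c *: u) v = c * dotv u v.
Proof. by rewrite mulr_sumr; apply: eq_bigr => i _; rewrite mxE mulrA. Qed.

Lemma dotvNl u v : dotv (- u) v = - dotv u v.
Proof. by rewrite -scaleN1r dotvZl mulN1r. Qed.

Lemma dotvBl u v w : dotv (u - v) w = dotv u w - dotv v w.
Proof. by rewrite dotvDl dotvNl. Qed.

Lemma dotv_sqrB u v : dotv (u - v) (u - v) = dotv u u - 2 * dotv u v + dotv v v.
Proof.
rewrite dotvBl ![dotv _ (u - v)]dotvC !dotvBl [dotv v u]dotvC; ring.
Qed.

Lemma dotvv_ge0 u : 0 <= dotv u u.
Proof. by apply: sumr_ge0 => i _; rewrite -expr2 sqr_ge0. Qed.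

Variable K : set 'rV[R]_N.
Hypothesis K0 : (K !=set0)%classic.
Hypothesis cK : compact K.
Hypothesis convK : forall (c : R) x y, 0 <= c <= 1 -> K x -> K y -> K (x + c *: (y - x)).

Lemma nearest_exists x : exists p, K p /\
  forall y, K y -> dotv (x - p) (x - p) <= dotv (x - y) (x - y).
Proof.
have cont : continuous (fun y : 'rV[R]_N => dotv (x - y) (x - y)).
  rewrite /dotv; apply: continuous_big => [|i _ y]; first exact: add_continuous.
  have ci : continuous (fun z : 'rV[R]_N => (x - z) 0 i).
    have -> : (fun z : 'rV[R]_N => (x - z) 0 i) = (fun z => x 0 i - z 0 i).
      by apply/funext => z; rewrite !mxE.
    move=> z; apply: (@continuousB _ R^o _ (cst (x 0 i)) (fun z : 'rV[R]_N => z 0 i)).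
      exact: cst_continuous.
    exact: coord_continuous.
  by apply: (@continuousM _ _ (fun z : 'rV[R]_N => (x - z) 0 i)); exact: ci.
have [p pK pmin] := EVT_min_rV K0 cK (continuous_subspaceT cont).
exists p; split; first by rewrite inE in pK.
by move=> y Ky; apply: pmin; rewrite inE.
Qed.

Definition nearest x : 'rV[R]_N := projT1 (cid (nearest_exists x)).

Lemma nearest_in x : K (nearest x).
Proof. by rewrite /nearest; case: cid => p []. Qed.

Lemma nearest_min x y : K y ->
  dotv (x - nearest x) (x - nearest x) <= dotv (x - y) (x - y).
Proof. by have [_] := projT2 (cid (nearest_exists x)); exact. Qed.

(** First-order condition at the minimum: moving from the nearest point towards
[y] cannot decrease the distance to [x]. *)
Lemma nearest_obtuse x y : K y -> dotv (x - nearest x) (y - nearest x) <= 0.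
Proof.
move=> Ky; set u := x - _; set v := y - _.
have var c : 0 < c -> c <= 1 -> 2 * dotv u v <= c * dotv v v.
  move=> c0 c1.
  have Kz : K (nearest x + c *: v).
    by apply: (convK _ (nearest_in x) Ky); rewrite (ltW c0) c1.
  have := nearest_min x Kz; rewrite opprD addrA -/u (dotv_sqrB u).
  rewrite [dotv u (c *: v)]dotvC !dotvZl [dotv v u]dotvC [dotv v (c *: v)]dotvC dotvZl.
  move=> h; rewrite -(ler_pM2l c0); lra.
rewrite leNgt; apply/negP => uv0.
have v0 := dotvv_ge0 v.
set s := dotv u v in uv0 var *; set q := dotv v v in v0 var *.
pose c := Num.min 1 (s / (q + 1)).
have c0 : 0 < c by rewrite lt_min ltr01 divr_gt0//; lra.
have := var c c0; rewrite ge_min lexx => /(_ isT); apply/negP; rewrite -ltNge.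
have : c * q <= s / (q + 1) * q by rewrite ler_wpM2r// ge_min lexx orbT.
move=> /le_lt_trans; apply.
by rewrite mulrAC ltr_pdivrMr; [nra|lra].
Qed.

Definition sqdist x : R := dotv (x - nearest x) (x - nearest x).

Lemma sqdist_ge0 x : 0 <= sqdist x. Proof. exact: dotvv_ge0. Qed.

Lemma sqdist_eq0 x : K x -> sqdist x = 0.
Proof.
move=> Kx; apply/eqP; rewrite eq_le sqdist_ge0 andbT.
by apply: le_trans (nearest_min x Kx) _; rewrite subrr /dotv big1// => i _; rewrite mxE mul0r.
Qed.

(** The gradient inequality for the convex function [sqdist].  With [u] and [w] the
vectors from the nearest points to [x] and to [y], expand [|w - u|^2 >= 0]; the
obtuse angle at [nearest x] bounds the scalar product of [w] and [u] from below. *)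
Lemma sqdist_tangent x y : sqdist x - sqdist y <= 2 * dotv (x - nearest x) (x - y).
Proof.
have := nearest_obtuse x (nearest_in y); rewrite /sqdist.
have := dotvv_ge0 ((y - nearest y) - (x - nearest x)).
set u := x - nearest x; set w := y - nearest y; rewrite (dotv_sqrB w u) => h1 h2.
have h3 : dotv w u = - dotv u (x - y) + dotv u u - dotv u (nearest y - nearest x).
  have -> : w = - (x - y) + u - (nearest y - nearest x).
    by rewrite /w /u; apply/rowP => i; rewrite !mxE; ring.
  rewrite (dotvBl (- (x - y) + u)) (dotvDl (- (x - y)) u) (dotvNl (x - y)).
  by rewrite (dotvC (x - y) u) (dotvC (nearest y - nearest x) u).
lra.
Qed.

Lemma dotv_xcol u x k l :
  dotv u (x - xcol k l x) = (u 0 k - u 0 l) * (x 0 k - x 0 l).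
Proof.
have [->|kl] := eqVneq k l.
  rewrite !subrr mul0r /dotv big1// => i _.
  by rewrite !mxE tperm1 perm1 subrr mulr0.
rewrite /dotv (bigD1 k)//= (bigD1 l)/=; last by rewrite eq_sym.
rewrite big1 ?addr0; last first.
  move=> i /andP[ik il]; rewrite !mxE tpermD 1?eq_sym//.
  by rewrite subrr mulr0.
by rewrite !mxE tpermL tpermR; ring.
Qed.

Lemma sum_sqr_pair_diff u :
  \sum_k \sum_l (u 0 k - u 0 l) ^+ 2 <= 2 * N%:R * dotv u u.
Proof.
set s := \sum_l u 0 l.
have E k : \sum_l (u 0 k - u 0 l) ^+ 2 =
    N%:R * (u 0 k * u 0 k) - 2 * s * u 0 k + dotv u u.
  transitivity (\sum_l (u 0 k * u 0 k - 2 * u 0 k * u 0 l + u 0 l * u 0 l)).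
    by apply: eq_bigr => l _; ring.
  rewrite big_split sumrB/=; congr (_ - _ + _).
    by rewrite sumr_const card_ord -[LHS]mulr_natl.
  by rewrite -mulr_sumr -/s mulrAC.
rewrite (eq_bigr _ (fun k _ => E k)) big_split sumrB/= -!mulr_sumr -/s -/(dotv u u).
rewrite sumr_const card_ord -[dotv u u *+ N]mulr_natl.
have := sqr_ge0 s; rewrite expr2; lra.
Qed.

End projection.

(** * The two-set inequality *)

Section two_sets.
Context {R : realType} (N : nat) (T : finType) (to : {action {perm 'I_N} &-> T}).
Variables (S : {set T}) (X : T -> 'rV[R]_N) (a b : R) (K : set 'rV[R]_N).
Hypothesis trS : [transitive [set: {perm 'I_N}]%SET, on S | to].
Hypothesis N0 : (0 < N)%N.
Hypothesis ab : a < b.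
Hypothesis X_swap : forall t k l, X (to t (tperm k l)) = xcol k l (X t).
Hypothesis X_box : forall t i, t \in S -> a <= X t 0 i <= b.
Hypothesis K_box : forall y i, K y -> a <= y 0 i <= b.
Hypothesis cK : compact K.
Hypothesis convK : forall (c : R) x y, 0 <= c <= 1 -> K x -> K y -> K (x + c *: (y - x)).

(** The squared distance to [K] is self-bounding with [v = 4 (b - a)^2], and
[17 v = 68 (b - a)^2].  It vanishes on [A] and is at least [r^2] on [B], which
bounds the two factors of [self_bounding_mgf] from below. *)
Theorem two_set_inequality (A B : {set T}) r :
  A \subset S -> B \subset S -> 0 <= r -> (forall t, t \in A -> K (X t)) ->
  (forall t y, t \in B -> K y -> r <= enorm (X t - y)) ->
  #|A|%:R * #|B|%:R * expR (r ^+ 2 / (68 * (b - a) ^+ 2)) <= #|S|%:R ^+ 2.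
Proof.
move=> AS BS r0 AK Bfar.
have [->|[t0 t0A]] := set_0Vmem A; first by rewrite cards0 !mul0r sqr_ge0.
have K0 : (K !=set0)%classic by exists (X t0); exact: AK.
set D := b - a; have D0 : 0 < D by rewrite subr_gt0.
pose p := @nearest _ _ _ K0 cK.
pose h t := @sqdist _ _ _ K0 cK (X t).
pose u t := X t - p (X t).
have h0 t : 0 <= h t by exact: sqdist_ge0.
pose v := 4 * D ^+ 2; have v0 : 0 < v by rewrite mulr_gt0// exprn_gt0.
have h_swap t k l : h t - h (to t (tperm k l)) <=
    2 * ((u t 0 k - u t 0 l) * (X t 0 k - X t 0 l)).
  by rewrite /h X_swap -dotv_xcol; exact: sqdist_tangent.
have uD t i : t \in S -> `|u t 0 i| <= D.
  move=> tS; have := X_box i tS; have := K_box i (@nearest_in _ _ _ K0 cK (X t)).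
  by rewrite /u !mxE /D ler_norml => ? ?; lra.
have XD t k l : t \in S -> `|X t 0 k - X t 0 l| <= D.
  move=> tS; have := X_box k tS; have := X_box l tS.
  by rewrite ler_norml /D => ? ?; lra.
have h_diff t k l : t \in S -> h t - h (to t (tperm k l)) <= v.
  move=> tS; apply: le_trans (h_swap t k l) _.
  have -> : v = 2 * (D + D) * D by rewrite /v; ring.
  rewrite -mulrA ler_pM2l//; apply: le_trans (ler_norm _) _; rewrite normrM.
  by rewrite ler_pM// ?XD// (le_trans (ler_normB _ _))// lerD// uD.
have h_var t : t \in S ->
    \sum_k \sum_l ppart (h t - h (to t (tperm k l))) ^+ 2 <= 2 * #|'I_N|%:R * v * h t.
  move=> tS; apply: (@le_trans _ _ (v * \sum_k \sum_l (u t 0 k - u t 0 l) ^+ 2)).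
    rewrite mulr_sumr; apply: ler_sum => k _; rewrite mulr_sumr; apply: ler_sum => l _.
    have -> : v * (u t 0 k - u t 0 l) ^+ 2 = (2 * (`|u t 0 k - u t 0 l| * D)) ^+ 2.
      by rewrite !exprMn real_normK ?num_real// /v; ring.
    have p0 : 0 <= ppart (h t - h (to t (tperm k l))) by rewrite le_max lexx.
    have q0 : 0 <= 2 * (`|u t 0 k - u t 0 l| * D) by rewrite !mulr_ge0// ltW.
    rewrite lerXn2r ?nnegrE// ge_max q0/=.
    apply: le_trans (h_swap t k l) _; rewrite ler_pM2l//.
    apply: le_trans (ler_norm _) _; rewrite normrM.
    by rewrite ler_wpM2l// XD.
  rewrite card_ord; have -> : 2 * N%:R * v * h t = v * (2 * N%:R * h t) by ring.
  by rewrite ler_pM2l//; exact: sum_sqr_pair_diff.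
have I0 : (0 < #|'I_N|)%N by rewrite card_ord.
have S0 : 0 < #|S|%:R :> R by rewrite ltr0n (atrans_card_gt0 trS).
have main := self_bounding_mgf trS I0 h0 v0 h_diff h_var.
have mA : #|A|%:R / #|S|%:R <= mgf S h (- v^-1).
  rewrite ler_pM2r ?invr_gt0//.
  have -> : #|A|%:R = \sum_(t in A) 1 :> R by rewrite sumr_const.
  rewrite [leRHS](big_setID A)/= (finset.setIidPr AS) -[leLHS]addr0 lerD//.
    apply: ler_sum => t tA; rewrite /h sqdist_eq0; last exact: AK.
    by rewrite mulr0 expR0.
  by apply: sumr_ge0 => t _; exact: expR_ge0.
have mB : #|B|%:R * expR (r ^+ 2 / (68 * D ^+ 2)) / #|S|%:R <= mgf S h (17 * v)^-1.
  rewrite ler_pM2r ?invr_gt0// mulr_natl -sumr_const.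
  rewrite [leRHS](big_setID B)/= (finset.setIidPr BS) -[leLHS]addr0 lerD//.
    apply: ler_sum => t tB; rewrite ler_expR /v.
    have -> : 17 * (4 * D ^+ 2) = 68 * D ^+ 2 by ring.
    rewrite mulrC ler_pM2l ?invr_gt0 ?mulr_gt0// ?exprn_gt0//.
    have := Bfar t _ tB (@nearest_in _ _ _ K0 cK (X t)).
    rewrite /enorm /h /sqdist /dotv => rle.
    have E : \sum_i (X t - p (X t)) 0 i * (X t - p (X t)) 0 i =
        \sum_i (X t - p (X t)) 0 i ^+ 2 by apply: eq_bigr => i _; rewrite expr2.
    rewrite E -[leRHS]sqr_sqrtr; last by apply: sumr_ge0 => i _; exact: sqr_ge0.
    by rewrite lerXn2r// ?nnegrE ?sqrtr_ge0.
  by apply: sumr_ge0 => t _; exact: expR_ge0.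
have : #|B|%:R * expR (r ^+ 2 / (68 * D ^+ 2)) / #|S|%:R * (#|A|%:R / #|S|%:R) <= 1.
  apply: le_trans main; apply: ler_pM mB mA.
  - by rewrite !mulr_ge0 ?invr_ge0// expR_ge0.
  - by rewrite mulr_ge0.
rewrite -(ler_pM2r (mulr_gt0 S0 S0)) mul1r -expr2; apply: le_trans.
by apply: eq_ler; field; rewrite gt_eqF.
Qed.

End two_sets.

(** * Words of the multislice as an orbit of the symmetric group *)

Section tuple_action.
Variables (N : nat) (C : finType).
Implicit Types t : N.-tuple C.

(** The inverse makes this a right action, as the composition order of
permutations requires; transpositions are their own inverses. *)
Definition permute_tuple t (s : {perm 'I_N}) : N.-tuple C :=
  [tuple tnth t ((s^-1)%g i) | i < N].

Lemma permute_tuple1 : permute_tuple^~ 1%g =1 id.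
Proof. by move=> t; apply: eq_from_tnth => i; rewrite tnth_mktuple invg1 perm1. Qed.

Lemma permute_tupleM t : act_morph permute_tuple t.
Proof.
move=> s s'; apply: eq_from_tnth => i.
by rewrite !tnth_mktuple invMg permM.
Qed.

Canonical tuple_action := TotalAction permute_tuple1 permute_tupleM.

Definition arrangements (kappa : C -> nat) : {set N.-tuple C} :=
  [set t | [forall c, #|[set i | tnth t i == c]%SET| == kappa c]]%SET.

Lemma count_mem_tnth t c : #|[set i | tnth t i == c]%SET| = count_mem c t.
Proof.
rewrite -sum1_count big_tuple -sum1_card.
by apply: eq_bigl => i; rewrite inE.
Qed.

Lemma arrangements_transitive kappa : arrangements kappa != finset.set0 ->
  [transitive [set: {perm 'I_N}]%SET, on arrangements kappa | tuple_action].
Proof.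
move=> /set0Pn[t0 t0S]; apply/imsetP; exists t0 => //.
have cnt t c : t \in arrangements kappa -> count_mem c t = kappa c.
  by rewrite inE => /forallP/(_ c)/eqP; rewrite count_mem_tnth.
apply/finset.setP => t; apply/idP/orbitP => [tS|[s _ <-]].
  have /tuple_permP[s E] : perm_eq t t0.
    by apply/allP => c _ /=; rewrite !cnt.
  exists (s^-1)%g => //; apply: eq_from_tnth => i.
  rewrite tnth_mktuple invgK; have -> : t = [tuple tnth t0 (s i) | i < N].
    exact: val_inj.
  by rewrite tnth_mktuple.
rewrite inE; apply/forallP => c; rewrite -(cnt t0 c t0S) -count_mem_tnth.
rewrite -(card_imset _ (@perm_inj _ (s^-1)%g)); apply/eqP/eq_card => i.
rewrite inE; apply/imsetP/idP => [[j]|].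
  rewrite inE => /eqP jc ->; move: jc; rewrite tnth_mktuple => ->; exact: eqxx.
move=> ic; exists (s i); last by rewrite permK.
by rewrite inE tnth_mktuple permK.
Qed.

End tuple_action.

Section multislice_tuples.
Context {R : realType} (L N : nat) (kappa : 'I_L -> nat) (x : L.-tuple R).
Hypothesis x_sorted : sorted <%R x.

Definition word (t : N.-tuple 'I_L) : 'rV[R]_N := \row_i tnth x (tnth t i).

Lemma word_inj : injective word.
Proof.
move=> s t /rowP st; apply: eq_from_tnth => i.
have xu : uniq x by apply: lt_sorted_uniq.
by have := st i; rewrite !mxE; apply: (tuple_uniqP x xu).
Qed.

Lemma word_swap t k l : word (tuple_action N 'I_L t (tperm k l)) = xcol k l (word t).
Proof. by apply/rowP => i; rewrite !mxE tnth_mktuple tpermV. Qed.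

Lemma word_multislice t : multislice kappa x (word t) <-> t \in arrangements N kappa.
Proof.
have xu : uniq x by apply: lt_sorted_uniq.
have E l : #|[set i : 'I_N | word t 0 i == tnth x l]%SET| =
    #|[set i | tnth t i == l]%SET|.
  apply: eq_card => i; rewrite !inE mxE; apply/eqP/eqP => [|->//].
  exact: (tuple_uniqP x xu).
rewrite inE; split=> [[_ c]|/forallP c].
  by apply/forallP => l; rewrite -E c.
split=> [i|l]; first by rewrite mxE mem_tnth.
by rewrite E; exact/eqP.
Qed.

Lemma multislice_word w : multislice kappa x w -> exists t, w = word t.
Proof.
move=> [wx _]; have h i : exists l, w 0 i == tnth x l.
  by have /tnthP[l ->] := wx i; exists l.
exists [tuple xchoose (h i) | i < N]; apply/rowP => i.
by rewrite mxE tnth_mktuple; exact/eqP/(xchooseP (h i)).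
Qed.

(** Words are encoded by the indices of their letters, which makes the multislice
a finite orbit and its uniform law a count. *)
Lemma card_multislice (A : set 'rV[R]_N) :
  #|` fset_set (A `&` multislice kappa x)%classic| =
  #|[set t in arrangements N kappa | `[< A (word t) >] ]%SET|.
Proof.
set E := finset _.
have -> : fset_set (A `&` multislice kappa x)%classic = [fset word t | t in E]%fset.
  apply/fsetP => w; rewrite in_fset_set; last first.
    by apply: finite_setIr; exact: finite_multislice.
  apply/idP/imfsetP => [|[t /= tE ->]].
    rewrite inE => -[Aw Mw]; have [t wE] := multislice_word Mw.
    exists t => //=; rewrite finset.in_set -wE; apply/andP; split; last exact/asboolP.
    by apply/word_multislice; rewrite -wE.
  move: tE; rewrite finset.in_set => /andP[tS /asboolP At].
  by rewrite inE; split=> //; apply/word_multislice.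
by rewrite card_imfset ?cardE//; exact: word_inj.
Qed.

End multislice_tuples.

(** * Convex Lipschitz functions on the multislice *)

Local Open Scope classical_set_scope.
Local Open Scope ring_scope.

Section sublevel.
Context {R : realType} (N : nat) (f : 'rV[R]_N -> R) (Lambda : R).
Hypothesis f_convex : convex_function [set: 'rV[R]_N] f.
Hypothesis Lambda_gt0 : 0 < Lambda.
Hypothesis f_lip : euclidean_lipschitz Lambda f.

Lemma enorm_le_norm (v : 'rV[R]_N) : enorm v <= Num.sqrt N%:R * `|v|.
Proof.
have -> : `|v| = Num.sqrt (`|v| ^+ 2) by rewrite sqrtr_sqr normr_id.
rewrite /enorm -sqrtrM ?ler0n// ler_wsqrtr//.
have -> : N%:R * `|v| ^+ 2 = \sum_(i < N) `|v| ^+ 2.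
  by rewrite sumr_const card_ord mulr_natl.
apply: ler_sum => i _; rewrite -real_normK ?num_real// lerXn2r ?nnegrE//.
rewrite [leRHS]/Num.norm/= mx_normrE; apply/bigmax_geP; right.
by exists (0, i).
Qed.

Lemma euclidean_lipschitz_continuous : continuous f.
Proof.
move=> y; apply/(@cvgrPdist_le _ R^o _ _ (nbhs_filter y)) => e e0.
set c := Lambda * Num.sqrt N%:R + 1.
have c0 : 0 < c by rewrite ltr_wpDl// mulr_ge0 ?sqrtr_ge0// ltW.
have d0 : 0 < e / c by rewrite divr_gt0.
near=> z.
apply: le_trans (f_lip y z) _.
have zd : `|y - z| <= e / c.
  by near: z; apply: (@cvgr_dist_le _ _ _ _ _ id y) => //; exact: cvg_id.
apply: (@le_trans _ _ (c * (e / c))); last by rewrite mulrC divfK ?gt_eqF.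
apply: (@le_trans _ _ (c * `|y - z|)); last by rewrite ler_pM2l.
apply: le_trans (ler_wpM2l (ltW Lambda_gt0) (enorm_le_norm _)) _.
by rewrite mulrA ler_wpM2r// /c lerDl.
Unshelve. all: by end_near. Qed.

(** The cube makes the sublevel set compact, and keeps the points of the set at
bounded coordinatewise distance from the words. *)
Definition boxed_sublevel (a b c : R) : set 'rV[R]_N :=
  [set y : 'rV[R]_N | (forall i, a <= y 0 i <= b) /\ f y <= c].

Lemma compact_boxed_sublevel a b c : compact (boxed_sublevel a b c).
Proof.
have cbox : compact [set y : 'rV[R]_N | forall i, `[a, b]%classic (y ord0 i)].
  by apply: (@rV_compact R N (fun=> `[a, b]%classic)) => _; exact: segment_compact.
apply: (subclosed_compact _ cbox); last first.
  by move=> y [yab _] i /=; rewrite in_itv/=; exact: yab.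
have -> : boxed_sublevel a b c =
    [set y : 'rV[R]_N | forall i, `[a, b]%classic (y ord0 i)] `&` f @^-1` [set z | z <= c].
  apply/seteqP; split=> [y [yab yc]|y [yab yc]].
    by split=> // i; rewrite /= in_itv/=; exact: yab.
  by split=> // i; have := yab i; rewrite /= in_itv.
apply: closedI; first by apply: compact_closed => //; exact: norm_hausdorff.
apply: preimage_closed; last exact: closed_le.
by move=> y _; exact: euclidean_lipschitz_continuous.
Qed.

Lemma convex_boxed_sublevel a b c k y z : 0 <= k <= 1 ->
  boxed_sublevel a b c y -> boxed_sublevel a b c z ->
  boxed_sublevel a b c (y + k *: (z - y)).
Proof.
move=> /andP[k0 k1] [yab fy] [zab fz]; split=> [i|].
  rewrite !mxE; have := yab i; have := zab i => /andP[h1 h2] /andP[h3 h4].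
  have : 0 <= k * (z 0 i - a) by rewrite mulr_ge0// subr_ge0.
  have : 0 <= k * (b - z 0 i) by rewrite mulr_ge0// subr_ge0.
  have : 0 <= (1 - k) * (y 0 i - a) by rewrite mulr_ge0// subr_ge0.
  have : 0 <= (1 - k) * (b - y 0 i) by rewrite mulr_ge0// subr_ge0.
  lra.
have fk : f (k *: z + (1 - k) *: y) <= k * f z + (1 - k) * f y.
  exact: (f_convex (Itv01 k0 k1) (mem_setT z) (mem_setT y)).
have -> : y + k *: (z - y) = k *: z + (1 - k) *: y.
  by rewrite scalerBl scale1r scalerBr addrCA.
apply: le_trans fk _.
have : 0 <= k * (c - f z) by rewrite mulr_ge0// subr_ge0.
have : 0 <= (1 - k) * (c - f y) by rewrite mulr_ge0// subr_ge0.
lra.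
Qed.

End sublevel.

Section level_gap.
Context {R : realType} (L : nat) (kappa : 'I_L -> nat) (N : nat) (x : L.-tuple R).
Context (f : 'rV[R]_N -> R) (Lambda : R).
Hypothesis L2 : (2 <= L)%N.
Hypothesis kappa0 : forall l, (0 < kappa l)%N.
Hypothesis NE : N = (\sum_(l < L) kappa l)%N.
Hypothesis x_sorted : sorted <%R x.
Hypothesis f_convex : convex_function [set: 'rV[R]_N] f.
Hypothesis Lambda_gt0 : 0 < Lambda.
Hypothesis f_lip : euclidean_lipschitz Lambda f.

Local Notation P := (uniform_on R (multislice (N := N) kappa x)).

(** By the Lipschitz property a rise of [s] in the value of [f] needs a distance
of at least [s / Lambda]. *)
Theorem level_gap c s : 0 <= s ->
  P [set w : 'rV[R]_N | f w <= c] * P [set w : 'rV[R]_N | c + s <= f w] <=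
  expR (- (s ^+ 2 / (68 * Lambda ^+ 2 * diameter x ^+ 2))).
Proof.
move=> s0; set S := arrangements N kappa.
set A := [set t in S | `[< f (word x t) <= c >] ]%SET.
set B := [set t in S | `[< c + s <= f (word x t) >] ]%SET.
have cardS : #|` fset_set (multislice (N := N) kappa x)| = #|S|.
  rewrite -[multislice _ _]setTI card_multislice//; congr #|pred_of_set _|.
  by apply/finset.setP => t; rewrite finset.in_set asboolT// andbT.
have PE Q : P Q = #|[set t in S | `[< Q (word x t) >] ]%SET|%:R / #|S|%:R.
  by rewrite /uniform_on card_multislice// cardS.
rewrite !PE/= -/A -/B.
have [w Mw] := multislice_neq0 x_sorted NE.
have [t0 wE] := multislice_word Mw.
have t0S : t0 \in S by apply/(word_multislice kappa x_sorted t0); rewrite -wE.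
have S0 : 0 < #|S|%:R :> R by rewrite ltr0n; apply/card_gt0P; exists t0.
have trS : [transitive [set: {perm 'I_N}]%SET, on S | tuple_action N 'I_L].
  by apply: arrangements_transitive; apply/set0Pn; exists t0.
have N0 : (0 < N)%N.
  by rewrite NE (bigD1 (Ordinal L2))//= addn_gt0 kappa0.
have xle (i j : nat) : (i < L)%N -> (j < L)%N -> (x`_i <= x`_j) = (i <= j)%N.
  by move=> iL jL; rewrite (lt_sorted_leq_nth _ x_sorted)// inE size_tuple.
have L0 : (0 < L)%N by exact: ltn_trans L2.
have LP : (L.-1 < L)%N by rewrite ltn_predL.
have D0 : x`_0 < x`_L.-1.
  by rewrite ltNge xle// -ltnNge -ltnS prednK.
have box (t : N.-tuple 'I_L) i : x`_0 <= word x t 0 i <= x`_L.-1.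
  rewrite mxE (tnth_nth 0); have lL := ltn_ord (tnth t i).
  by rewrite !xle//= -ltnS prednK.
have AS : A \subset S by apply/fintype.subsetP => t; rewrite finset.in_set => /andP[].
have BS : B \subset S by apply/fintype.subsetP => t; rewrite finset.in_set => /andP[].
have r0 : 0 <= s / Lambda by rewrite divr_ge0// ltW.
have := two_set_inequality trS N0 D0 (word_swap x) (fun t i _ => box t i)
  (fun y i (Ky : boxed_sublevel f x`_0 x`_L.-1 c y) => Ky.1 i)
  (compact_boxed_sublevel Lambda_gt0 f_lip (a := _) (b := _) (c := _))
  (convex_boxed_sublevel f_convex (a := _) (b := _) (c := _)) AS BS r0.
have AK t : t \in A -> boxed_sublevel f x`_0 x`_L.-1 c (word x t).
  by rewrite finset.in_set => /andP[_ /asboolP fc]; split=> // i; exact: box.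
have far t y : t \in B -> boxed_sublevel f x`_0 x`_L.-1 c y ->
    s / Lambda <= enorm (word x t - y).
  rewrite finset.in_set => /andP[_ /asboolP fc] [_ fy].
  rewrite ler_pdivrMr// mulrC; apply: le_trans (f_lip _ _).
  by apply: le_trans (ler_norm _); lra.
move=> /(_ AK far); rewrite -/(diameter x).
have -> : (s / Lambda) ^+ 2 / (68 * diameter x ^+ 2) =
    s ^+ 2 / (68 * Lambda ^+ 2 * diameter x ^+ 2).
  have d0 : 0 < diameter x by rewrite subr_gt0.
  by field; rewrite !gt_eqF.
move=> main; rewrite expRN -[leRHS]mul1r ler_pdivlMr ?expR_gt0//.
have SS : 0 < #|S|%:R ^+ 2 :> R by rewrite exprn_gt0.
rewrite -(ler_pM2r SS) mul1r; apply: le_trans main.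
by apply: eq_ler; field; rewrite gt_eqF.
Qed.

End level_gap.

Lemma uniform_on_le (R : realType) (T : choiceType) (S A B : set T) :
  finite_set S -> A `<=` B -> uniform_on R S A <= uniform_on R S B.
Proof.
move=> finS AB; rewrite /uniform_on ler_wpM2r ?invr_ge0// ler_nat.
apply: fsubset_leq_card; rewrite -fset_set_sub; try exact: finite_setIr.
exact: setSI.
Qed.

Lemma uniform_onU_le (R : realType) (T : choiceType) (S A B : set T) :
  finite_set S -> uniform_on R S (A `|` B) <= uniform_on R S A + uniform_on R S B.
Proof.
move=> finS; rewrite /uniform_on -mulrDl ler_wpM2r ?invr_ge0// -natrD ler_nat.
rewrite setIUl fset_setU; try exact: finite_setIr.
by rewrite cardfsU leq_subr.
Qed.

Theorem corollary1p8 (R : realType) (L : nat) (hL : (2 <= L)%N)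
    (kappa : 'I_L -> nat) (hkappa : forall l, (0 < kappa l)%N)
    (N : nat) (hN : N = (\sum_(l < L) kappa l)%N)
    (x : L.-tuple R) (hx : sorted <%R x)
    (f : 'rV[R]_N -> R) (hconv : convex_function [set: 'rV[R]_N] f)
    (Lambda : R) (hLambda : 0 < Lambda) (hlip : euclidean_lipschitz Lambda f)
    (m : R) (hm : is_median (uniform_on R (multislice kappa x)) f m)
    (t : R) (ht : 0 <= t) :
  uniform_on R (multislice kappa x) [set w : 'rV[R]_N | t <= `|f w - m|]
    <= 4 * expR (- (t ^+ 2 / (144 * Lambda ^+ 2 * diameter x ^+ 2))).
Proof.
set P := uniform_on R _; set E := expR _.
have finS := @finite_multislice R L N kappa x.
have gap c : P [set w : 'rV[R]_N | f w <= c] * P [set w : 'rV[R]_N | c + t <= f w] <= E.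
  apply: le_trans (level_gap hL hkappa hN hx hconv hLambda hlip c ht) _.
  rewrite ler_expR lerN2 -[144](_ : 68 * (36 / 17) = _); last by field.
  set q := Lambda ^+ 2; set d := diameter x ^+ 2.
  have -> : 68 * (36 / 17) * q * d = (68 * q * d) * (36 / 17) by ring.
  have q0 : 0 <= q by exact: sqr_ge0.
  have d0 : 0 <= d by exact: sqr_ge0.
  rewrite invfM mulrA ler_piMr//; last by rewrite invf_div; lra.
  by rewrite divr_ge0 ?sqr_ge0// mulr_ge0// mulr_ge0.
have [low high] := hm.
have P0 A : 0 <= P A by rewrite /P /uniform_on divr_ge0.
have upper : P [set w : 'rV[R]_N | m + t <= f w] <= 2 * E.
  have := gap m; have : 0 <= (P [set w : 'rV[R]_N | f w <= m] - 2^-1) *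
      P [set w : 'rV[R]_N | m + t <= f w].
    by rewrite mulr_ge0// subr_ge0.
  rewrite -/P in low high *; lra.
have lower : P [set w : 'rV[R]_N | f w <= m - t] <= 2 * E.
  have := gap (m - t); rewrite subrK.
  have : 0 <= P [set w : 'rV[R]_N | f w <= m - t] *
      (P [set w : 'rV[R]_N | m <= f w] - 2^-1).
    by rewrite mulr_ge0// subr_ge0.
  lra.
apply: (@le_trans _ _ (P ([set w : 'rV[R]_N | m + t <= f w] `|`
    [set w : 'rV[R]_N | f w <= m - t]))).
  apply: uniform_on_le => // w /=; rewrite ler_normr => /orP[h|h]; [left|right] => /=; lra.
apply: le_trans (uniform_onU_le _ _ _ finS) _; rewrite -/P; lra.
Qed.
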